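(* Let $\mathcal{A}_1,\mathcal{A}_2,\dots$ be any sequence of alphabets with $|\mathcal{A}_i|=2$ for every $i$. Then for every $n\ge 0$, there are at least $1.35^n$ cube-free words in $\mathcal{A}_1\times\mathcal{A}_2\times\cdots\times\mathcal{A}_n$, i.e. cube-free words $c_1\cdots c_n$ with $c_i\in\mathcal{A}_i$ for all $i$.
   Context: An alphabet is a finite set. A cube is a word of the form $uuu$ with $u$ a nonempty word. A word is cube-free if none of its factors (contiguous subwords) is a cube. *)

(* Defs.v *)
From mathcomp Require Import all_boot.
From mathcomp Require Import finmap.
From mathcomp Require Import boolp.

Set Implicit Arguments.
Unset Strict Implicit.
Unset Printing Implicit Defensive.

Local Open Scope fset_scope.

Definition cube_free (T : eqType) (w : seq T) : Prop :=
  forall u : seq T, u != [::] -> ~~ infix (u ++ u ++ u) w.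

(* The product of the first n alphabets, as a set of words; positions count
   from 0, so A 0 is the alphabet of the first letter. *)
Fixpoint words (T : choiceType) (A : nat -> {fset T}) (n : nat) :
    {fset seq T} :=
  if n is m.+1 then [fset rcons w a | w in words A m, a in A m]
  else [fset [::]].

Lemma wordsP (T : choiceType) (A : nat -> {fset T}) (n : nat) (w : seq T) :
  reflect (size w = n /\ forall x0 i, (i < n)%N -> nth x0 w i \in A i)
          (w \in words A n).
Proof.
elim: n w => [|n IHn] w /=.
  by rewrite inE; apply: (iffP eqP) => [-> | [/size0nil]].
apply: (iffP idP) => [/imfset2P[v Hv [a Ha ->]] | [sw Hw]].
  have [sv Hv'] := IHn _ Hv; split=> [|x0 i]; first by rewrite size_rcons sv.
  rewrite nth_rcons sv ltnS leq_eqVlt => /predU1P [-> | lt_in].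
    by rewrite ltnn eqxx.
  by rewrite lt_in Hv'.
case/lastP: w sw Hw => [//|v a]; rewrite size_rcons => -[sv] Hw.
apply/imfset2P; exists v => /=; last first.
  by exists a => //=; have := Hw a n (ltnSn n); rewrite nth_rcons sv ltnn eqxx.
apply/IHn; split=> // x0 i lt_in.
by have := Hw x0 i (ltnW lt_in); rewrite nth_rcons sv lt_in.
Qed.

Definition cube_free_words (T : choiceType) (A : nat -> {fset T}) (n : nat) :
    {fset seq T} :=
  [fset w in words A n | `[< cube_free w >]].

(* Main.v *)
From Stdlib Require Import NArith.
Require Import Defs.
From mathcomp Require Import all_boot all_order all_algebra.
From mathcomp Require Import finmap boolp zify ring lra.

Set Implicit Arguments.
Unset Strict Implicit.
Unset Printing Implicit Defensive.

(* A nonnegative weight f(w), depending only on equalities between the last 18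
   letters of w, vanishes on words ending in a cube of period at most 6, and
   (1) if f(w) > 0 and x <> y, then f(wx) + f(wy) >= 1.455 f(w);
   (2) if w = v u u u with |u| >= 7, then f(w) <= 2.354 f(v u).
   Let S(n) be the sum of f over the words of length n, letters taken from the
   given alphabets, that are cube-free and all of whose prefixes have positive
   weight.  A word v u u u is determined by v u, which is shorter by 2|u|, so
     S(n+1) >= 1.455 S(n) - 2.354 (S(n+1-14) + S(n+1-16) + ...),
   and by induction S(n+1) >= (15/11) S(n).  The weight of the empty word is the
   maximum of f, so there are at least S(n) / S(0) >= (15/11)^n words.
   Properties (1) and (2) only involve equalities between boundedly many
   letters, and are checked by enumerating the equality patterns.
   Below, unlike here, words are read from the last letter to the first. *)

(** * Decision trees on equality patterns, and the search *)

Inductive dtree := Leaf of N | Test of nat & nat & dtree & dtree.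

(** The word is a function on all positions, so evaluation is total; finite words will be padded by
    fresh letters. *)
Fixpoint eval (U : eqType) (t : dtree) (g : nat -> U) : N :=
  match t with
  | Leaf v => v
  | Test i j y n => if g i == g j then eval y g else eval n g
  end.

(* Evaluation on a word of which only the prefix [s] is known. *)
Fixpoint peval (t : dtree) (s : seq nat) : option N :=
  match t with
  | Leaf v => Some v
  | Test i j y n =>
    if i < size s then if j < size s then
      if eqn (nth 0 s i) (nth 0 s j) then peval y s else peval n s
    else None else None
  end.

(* The nested conditionals, here and below, keep call-by-value evaluation from
   computing both arguments of a boolean operator. *)
Fixpoint dead_suffix (t : dtree) (s : seq nat) : bool :=
  match peval t s with
  | Some N0 => true
  | _ => if s is _ :: s' then dead_suffix t s' else false
  end.

(* Depth-first search over equality patterns: [s] is extended letter by letter,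
   with one of the [K] known letters or with a fresh one, until [chk] holds. *)
Fixpoint explore (chk : seq nat -> bool) (fuel K : nat) (s : seq nat) : bool :=
  if chk s then true else
  if fuel is fuel'.+1 then
    all (fun c => explore chk fuel' K (rcons s c)) (iota 0 K)
      && explore chk fuel' K.+1 (rcons s K)
  else false.

(** Property (1), with factor 1455/1000, for the word [g]. Once the weight of [g] is known to be 0,
    the weights of its two extensions need not be determined. *)
Definition growth_ok (t : dtree) (x y : nat) (g : seq nat) : bool :=
  match peval t g, peval t (x :: g), peval t (y :: g) with
  | Some c, Some a, Some b => N.leb (1455 * c)%num (1000 * (a + b))%num
  | Some N0, _, _ => true
  | _, _, _ => false
  end.

(** The two candidate letters stand in front of the word, so that one search over patterns treats
    all three together. *)
Definition growth_check (t : dtree) (s : seq nat) : bool :=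
  if s is y :: x :: g then
    if growth_ok t x y g then true else dead_suffix t g
  else false.

(** Property (2), with factor 2354/1000. For periods up to 6 the right-hand side is set to 0, which
    forces weight 0. *)
Definition cube_ok (t : dtree) (p : nat) (b s : seq nat) : bool :=
  match peval t b, (if p <= 6 then Some N0 else peval t s) with
  | Some N0, _ => true
  | Some a, Some c => N.leb (1000 * a)%num (2354 * c)%num
  | _, _ => false
  end.

(* [s] is the beginning of the word u v, and [b] that of u u u v with |u| = p;
   as long as [size s < p], both begin with [s]. *)
Definition cube_check (t : dtree) (p : nat) (s : seq nat) : bool :=
  let b := if size s < p then s else take p s ++ take p s ++ s in
  if cube_ok t p b s then true else dead_suffix t (behead b).

(** * Soundness of the pattern search *)

Section Soundness.
Variable U : eqType.
Implicit Types (g b : nat -> U) (t : dtree) (s : seq nat).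

Definition shift g (k : nat) : nat -> U := fun i => g (k + i).

Definition scons (x : U) g : nat -> U :=
  fun i => if i is i'.+1 then g i' else x.

(** [phi] interprets the abstract letters of the pattern. It is injective only on letters that occur
    in [s], so its value at a fresh letter can still be chosen. *)
Definition matches (phi : nat -> U) s g :=
  {in s &, injective phi} /\ forall i, i < size s -> g i = phi (nth 0 s i).

Lemma peval_sound phi t s g v :
  matches phi s g -> peval t s = Some v -> eval t g = v.
Proof.
case=> phi_inj s_g; elim: t => [w | i j y IHy n IHn] /=; first by case.
case: ltnP => // lt_i; case: ltnP => // lt_j.
rewrite !s_g // (inj_in_eq phi_inj) ?mem_nth // -eqnE.
by case: (eqn _ _).
Qed.

Lemma matches_behead phi a s g :
  matches phi (a :: s) g -> matches phi s (shift g 1).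
Proof.
case=> phi_inj s_g; split=> [c d sc sd | i lt_i].
  by apply: phi_inj; rewrite inE ?sc ?sd orbT.
by rewrite [LHS]s_g.
Qed.

(** This justifies pruning: a word that has a suffix of weight 0 is never counted, so its pattern
    can be discarded. *)
Lemma dead_suffix_sound phi t s g :
  matches phi s g -> dead_suffix t s -> exists k, eval t (shift g k) = 0%num.
Proof.
elim: s g => [|a s IHs] g s_g /=.
  by case E: (peval t [::]) => [[|v]|] // _; exists 0; apply: peval_sound s_g E.
case E: (peval t (a :: s)) => [[|v]|] //= => [_||].
- by exists 0; apply: peval_sound s_g E.
- by case/(IHs _ (matches_behead s_g)) => k Ek; exists k.+1.
by case/(IHs _ (matches_behead s_g)) => k Ek; exists k.+1.
Qed.

(** Some branch of the search always follows the word [g]: its next letter is either the image of a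
    letter of the pattern or new. The letters of [s] stay below [K], so [K] is fresh. *)
Lemma explore_sound (chk : seq nat -> bool) (Q : (nat -> U) -> Prop) :
  (forall phi s g, matches phi s g -> chk s -> Q g) ->
  forall fuel K phi s g, matches phi s g -> all (ltn^~ K) s ->
  explore chk fuel K s -> Q g.
Proof.
move=> chkP; elim=> [|fuel IH] K phi s g s_g ltK /=.
  by case: ifP => // chk_s _; apply: chkP s_g chk_s.
case: ifP => [chk_s _ | _ /andP[/allP exK exS]]; first exact: chkP s_g chk_s.
case: (s_g) => phi_inj s_gi.
have [/mapP[c sc g_m]|new] := boolP (g (size s) \in [seq phi c | c <- s]).
  have ltc : c < K by apply: (allP ltK).
  apply: (IH K phi (rcons s c)); last by apply: exK; rewrite mem_iota.
    split=> [a b | i].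
      rewrite !mem_rcons !inE => /predU1P[->|sa] /predU1P[->|sb];
      exact: phi_inj.
    rewrite size_rcons nth_rcons ltnS leq_eqVlt => /predU1P[->|lt_i].
      by rewrite ltnn eqxx.
    by rewrite lt_i s_gi.
  by rewrite all_rcons /= ltc.
have ne_K c : c \in s -> (c == K) = false.
  by move=> sc; apply/eqP => Ec; have:= allP ltK c sc; rewrite Ec /= ltnn.
have ne_g c : c \in s -> phi c <> g (size s).
  by move=> sc Ec; case/negP: new; rewrite -Ec map_f.
(* Redefining [phi] at the fresh [K] preserves the match so far; injectivity persists because the
   new letter of [g] is not an image of an old one. *)
apply: (IH K.+1 (fun c => if c == K then g (size s) else phi c) (rcons s K)).
- split=> [a b | i].
    rewrite !mem_rcons !inE.
    move=> /predU1P[->|sa] /predU1P[->|sb] //; rewrite ?eqxx ?ne_K //.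
    + by move/esym/ne_g.
    + by move/ne_g.
    exact: phi_inj.
  rewrite size_rcons nth_rcons ltnS leq_eqVlt => /predU1P[->|lt_i].
    by rewrite ltnn !eqxx.
  by rewrite lt_i ne_K ?mem_nth // s_gi.
- by rewrite all_rcons /= ltnSn; apply: sub_all ltK => c /= /leqW.
exact: exS.
Qed.

Lemma growth_sound t fuel x y g :
  explore (growth_check t) fuel 2 [:: 0; 1] ->
  x <> y -> (forall k, eval t (shift g k) <> 0%num) ->
  (1455 * eval t g <= 1000 * (eval t (scons x g) + eval t (scons y g)))%num.
Proof.
move=> ex xy live.
(* The letters [y], [x] and the word [g] are packed into one word [h], as the search requires. *)
pose Q h := h 1 <> h 0 -> (forall k, eval t (shift (shift h 2) k) <> 0%num) ->
  (1455 * eval t (shift h 2) <= 1000 * (eval t (scons (h 1) (shift h 2))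
     + eval t (scons (h 0) (shift h 2))))%num.
suff: Q (scons y (scons x g)) by apply.
(* The initial pattern 0, 1 stands for [y], [x], which differ by hypothesis. *)
pose phi0 c := if c == 0 then y else x.
apply: (@explore_sound _ Q _ fuel 2 phi0) ex => //; last first.
  split=> [|[|[|i]]] //= a b; rewrite !inE.
  by case/orP=> /eqP-> /orP[] /eqP-> //= E; case: xy.
move=> phi s h s_h + h10 h_live.
case: s s_h => [|cy [|cx s]] // s_h /=.
have s_g := matches_behead (matches_behead s_h).
(* Prepending a letter already in the pattern keeps a match; this gives both extensions. *)
have hE z c : c \in cy :: cx :: s -> z = phi c ->
    matches phi (c :: s) (scons z (shift h 2)).
  move=> cs zc; case: s_h => phi_inj s_hi; split.
    move=> a b As Bs; apply: phi_inj.
      by move: As; rewrite inE => /predU1P[->//|As]; rewrite !inE As !orbT.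
    by move: Bs; rewrite inE => /predU1P[->//|Bs]; rewrite !inE Bs !orbT.
  by case=> [|i] //= lt_i; rewrite [LHS]s_hi.
have s_x : matches phi (cx :: s) (scons (h 1) (shift h 2)).
  by apply: hE; rewrite ?inE ?eqxx ?orbT //; case: s_h => _ /(_ 1); apply.
have s_y : matches phi (cy :: s) (scons (h 0) (shift h 2)).
  by apply: hE; rewrite ?inE ?eqxx ?orbT //; case: s_h => _ /(_ 0); apply.
case: ifP => [|_ /(dead_suffix_sound s_g)[k /h_live] //].
rewrite /growth_ok; case Eg: (peval t s) => [v|] //.
rewrite -[shift h 2]/(shift (shift h 1) 1) (peval_sound s_g Eg).
case Ex: (peval t (cx :: s)) => [a|]; last by case: v {Eg} => // _; lia.
case Ey: (peval t (cy :: s)) => [b|]; last by case: v {Eg} => // _; lia.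
rewrite (peval_sound s_x Ex) (peval_sound s_y Ey).
by case: (v) => [|v'] /N.leb_spec0.
Qed.

(** Here [b] is u u u v with |u| = [p]. Only proper suffixes of [b] are assumed to have nonzero
    weight, since [b] is the newly extended word, whose weight is to be bounded. *)
Lemma cube_sound t fuel p b : 0 < p ->
  explore (cube_check t p) fuel 0 [::] ->
  (forall i, i < 2 * p -> b i = b (p + i)) ->
  (forall k, eval t (shift b k.+1) <> 0%num) ->
  (1000 * eval t b <=
     if (p <= 6)%N then 0 else 2354 * eval t (shift b (2 * p)))%num.
Proof.
move=> p_gt0 ex b_per live.
(* The search runs over patterns of the shorter word u v, which determines u u u v. *)
pose Q g := forall b', shift b' (2 * p) = g ->
  (forall i, i < 2 * p -> b' i = b' (p + i)) ->
  (forall k, eval t (shift b' k.+1) <> 0%num) ->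
  (1000 * eval t b' <= if (p <= 6)%N then 0 else 2354 * eval t g)%num.
suff: Q (shift b (2 * p)) by apply.
apply: (@explore_sound _ Q _ fuel 0 (fun _ => b 0)) ex => //.
move=> {b b_per live} phi s g s_g + b Eg b_per live; rewrite /cube_check.
set s' := if size s < p then _ else _.
have bg i : i < p -> b i = g i.
  move=> lt_i; rewrite -Eg /shift b_per; last lia.
  by rewrite b_per; [congr b; lia | lia].
have bg' i : p <= i < 2 * p -> b i = g (i - p).
  by move=> lt_i; rewrite -Eg /shift b_per; [congr b; lia | lia].
have s_b : matches phi s' b.
  rewrite /s'; case: s_g => phi_inj s_gi; case: ltnP => size_s.
    by split=> // i lt_i; rewrite bg; [apply: s_gi | lia].
  split=> [c d|i].
    by rewrite !mem_cat => sc sd; apply: phi_inj;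
      [case/or3P: sc | case/or3P: sd] => //; apply: mem_take.
  rewrite !size_cat !nth_cat size_take_min => lt_i.
  have -> : minn p (size s) = p by lia.
  case: ltnP => [lt_ip|le_pi]; first by rewrite nth_take // bg // s_gi //; lia.
  case: ltnP => [lt_ip|le_pi']; first by rewrite nth_take // bg' ?s_gi //; lia.
  by rewrite -s_gi -?Eg /shift; [congr b; lia | lia].
case: ifP => [|_].
  rewrite /cube_ok; case Eb: (peval t s') => [v|] //.
  rewrite (peval_sound s_b Eb); case: v {Eb} => [|v]; first by case: ifP; lia.
  case: ifP => // _; case Es: (peval t s) => [c|] // /N.leb_spec0.
  by rewrite (peval_sound s_g Es).
have dead a s1 : s' = a :: s1 -> dead_suffix t s1 -> False.
  move=> Es'; rewrite Es' in s_b.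
  case/(dead_suffix_sound (matches_behead s_b)) => k.
  exact: live.
(* For the empty pattern [behead] removes nothing; a tree known to be 0 without reading any letter
   contradicts [live 0]. *)
case Es': s' => [|a s1] /=; last by move/(dead _ _ Es').
case E: (peval t [::]) => [[|v]|] // _.
by case: (live 0); apply: (@peval_sound phi _ [::]) E; split.
Qed.

Lemma eval_ext t g g' : g =1 g' -> eval t g = eval t g'.
Proof. by move=> gg'; elim: t => //= i j y -> n ->; rewrite !gg'. Qed.

(** This serves for long periods: when |u| is at least the number of letters read, u u u v and u v
    have equal weight. *)
Fixpoint reads_below (n : nat) t : bool :=
  if t is Test i j y n' then
    [&& i < n, j < n, reads_below n y & reads_below n n'] else true.

Lemma eval_reads n t g g' : reads_below n t ->
  (forall i, i < n -> g i = g' i) -> eval t g = eval t g'.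
Proof.
move=> + gg'; elim: t => //= i j y IHy z IHz /and4P[lti ltj /IHy-> /IHz->].
by rewrite !gg'.
Qed.

Fixpoint max_leaf t : N :=
  match t with
  | Leaf v => v
  | Test _ _ y n => N.max (max_leaf y) (max_leaf n)
  end.

Lemma eval_max t g : (eval t g <= max_leaf t)%num.
Proof. by elim: t => [v|i j y IHy n IHn] /=; [lia | case: ifP; lia]. Qed.

End Soundness.

(** * The weight function and its verification *)

Local Notation V v := (Leaf v%num).
Local Notation C i j y n := (Test i j y n).
(* An approximate fixed point, found numerically, of the operator sending f to
   w |-> (1/1.457) min (f(wx) + f(wy)) over all pairs x <> y, f being 0 on cubes
   of period at most 6, with the values lowered as required by (2). *)
Definition weight_tree : dtree :=
  C 0 2 (C 0 1 (V 0) (C 1 3 (C 1 4 (C 0 5 (C 0 6 (C 1 7 (C 2 8 (C 3 9 (C 4 10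
  (C 5 11 (C 6 12 (C 7 13 (C 8 14 (C 9 15 (C 10 16 (C 11 17 (V 0) (V 342)) (V
  342)) (V 611)) (V 611)) (V 719)) (V 786)) (V 822)) (V 822)) (V 850)) (V 850))
  (V 862)) (C 1 6 (C 2 7 (C 3 8 (C 3 9 (C 5 10 (C 6 11 (C 7 12 (C 8 13 (C 8 14
  (V 0) (V 526)) (V 526)) (V 526)) (V 705)) (V 761)) (V 841)) (V 841)) (V 841))
  (V 869))) (C 0 6 (C 1 7 (C 2 8 (C 3 9 (C 4 10 (C 5 11 (C 6 12 (C 7 13 (C 8 14
  (C 9 15 (C 10 16 (C 11 17 (V 0) (V 351)) (V 762)) (V 826)) (V 881)) (V 826))
  (V 881)) (V 826)) (V 881)) (V 826)) (V 881)) (V 826)) (V 881))) (C 0 4 (C 1 5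
  (V 0) (C 0 5 (C 1 6 (C 2 7 (C 3 8 (C 4 9 (C 4 10 (C 6 11 (C 7 12 (V 0) (V
  261)) (V 343)) (V 459)) (V 459)) (V 459)) (V 499)) (V 512)) (C 0 6 (C 1 7 (C
  2 8 (C 3 9 (C 4 10 (C 5 11 (C 6 12 (C 7 13 (C 8 14 (C 9 15 (C 10 16 (V 0) (V
  411)) (V 529)) (V 529)) (V 529)) (V 529)) (V 529)) (V 529)) (V 529)) (V 529))
  (V 529)) (V 529)))) (C 1 5 (C 0 6 (C 1 7 (C 2 8 (C 3 9 (C 4 10 (C 5 11 (C 6
  12 (C 7 13 (C 8 14 (C 9 15 (C 10 16 (C 11 17 (V 0) (V 529)) (V 529)) (V 812))
  (V 893)) (V 893)) (V 893)) (V 893)) (V 893)) (V 893)) (V 893)) (V 893)) (V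
  893)) (C 0 5 (C 1 6 (C 2 7 (C 3 8 (C 4 9 (C 5 10 (C 6 11 (C 7 12 (C 8 13 (C 9
  14 (V 0) (V 363)) (V 774)) (V 893)) (V 854)) (V 893)) (V 893)) (V 854)) (V
  893)) (C 0 6 (C 1 7 (C 2 8 (C 3 9 (C 4 10 (C 5 11 (C 6 12 (C 7 13 (C 8 14 (C
  9 15 (C 10 16 (C 11 17 (V 0) (V 363)) (V 363)) (V 645)) (V 838)) (V 893)) (V
  854)) (V 893)) (V 893)) (V 893)) (V 893)) (V 893)) (V 893))) (C 0 6 (C 1 7 (C
  2 8 (C 3 9 (C 4 10 (C 4 5 (C 5 11 (C 6 12 (C 7 13 (C 8 14 (C 9 15 (C 10 16 (C
  11 17 (V 0) (V 363)) (V 893)) (V 854)) (V 893)) (V 854)) (V 893)) (V 893)) (C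
  5 11 (C 6 12 (C 7 13 (C 8 14 (C 9 15 (C 10 16 (C 11 17 (V 0) (V 363)) (V
  774)) (V 854)) (V 893)) (V 854)) (V 893)) (V 854))) (V 893)) (V 854)) (V
  893)) (V 854)) (V 893)))))) (C 0 3 (C 1 4 (C 0 5 (C 0 6 (C 1 7 (C 2 8 (V 0)
  (V 577)) (V 577)) (C 1 6 (C 2 7 (C 2 8 (C 4 9 (C 5 10 (C 6 11 (C 7 12 (C 7 13
  (C 9 14 (V 0) (V 253)) (V 615)) (V 615)) (V 615)) (V 738)) (V 776)) (V 831))
  (V 831)) (V 831))) (C 1 5 (C 0 6 (C 1 7 (C 2 8 (C 3 9 (C 4 10 (C 5 11 (C 6 12
  (C 7 13 (C 8 14 (C 9 15 (C 10 16 (C 11 17 (V 0) (V 440)) (V 676)) (V 676)) (V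
  860)) (V 860)) (V 934)) (V 980)) (V 1005)) (V 1005)) (V 1024)) (V 1024)) (V
  1032)) (C 0 6 (C 1 7 (C 2 8 (C 3 9 (C 4 10 (C 5 11 (C 6 12 (C 7 13 (C 8 14 (C
  9 15 (C 10 16 (C 11 17 (V 0) (V 440)) (V 852)) (V 1035)) (V 1037)) (V 1035))
  (V 1037)) (V 1035)) (V 1037)) (V 1035)) (V 1037)) (V 1035)) (V 1037)))) (C 1
  5 (C 0 6 (C 1 7 (C 2 8 (C 3 9 (C 4 10 (C 5 11 (C 6 12 (C 7 13 (C 8 14 (C 9 15
  (C 10 16 (C 11 17 (V 0) (V 440)) (V 681)) (V 964)) (V 1007)) (V 1035)) (V
  1007)) (V 1035)) (V 1007)) (V 1045)) (V 1007)) (V 1035)) (V 1007)) (C 0 5 (C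
  1 6 (C 2 7 (C 2 8 (C 4 9 (C 5 10 (C 6 11 (C 7 12 (C 7 13 (C 9 14 (V 0) (V
  440)) (V 852)) (V 1045)) (V 1035)) (V 1045)) (V 1035)) (V 1035)) (V 1045)) (C
  0 6 (C 1 7 (C 2 8 (C 3 9 (C 4 10 (C 5 11 (C 6 12 (C 7 13 (C 8 14 (C 9 15 (C
  10 16 (C 11 17 (V 0) (V 604)) (V 604)) (V 886)) (V 1045)) (V 1045)) (V 1045))
  (V 1045)) (V 1045)) (V 1045)) (V 1045)) (V 1045)) (V 1045))) (C 4 5 (C 0 6 (C
  1 7 (C 2 8 (C 3 9 (C 4 10 (C 5 11 (C 6 12 (C 7 13 (C 8 14 (C 9 15 (C 10 16 (C
  11 17 (V 0) (V 440)) (V 975)) (V 975)) (V 1045)) (V 1035)) (V 1045)) (V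
  1045)) (V 1035)) (V 1035)) (V 1045)) (V 1035)) (V 1045)) (C 0 6 (C 1 7 (C 2 8
  (C 3 9 (C 4 10 (C 5 11 (C 6 12 (C 7 13 (C 8 14 (C 9 15 (C 10 16 (C 11 17 (V
  0) (V 440)) (V 852)) (V 1035)) (V 1045)) (V 1035)) (V 1045)) (V 1035)) (V
  1035)) (V 1035)) (V 1045)) (V 1035)) (V 1045)))))) (C 1 5 (C 0 4 (C 0 6 (C 3
  7 (C 2 8 (C 5 9 (C 4 10 (C 7 11 (V 0) (V 522)) (V 934)) (V 1136)) (V 1136))
  (C 1 7 (C 2 8 (C 3 9 (C 4 10 (C 5 11 (C 6 12 (C 7 13 (C 8 14 (C 9 15 (C 10 16
  (C 11 17 (V 0) (V 522)) (V 886)) (V 886)) (V 1080)) (V 1136)) (V 1136)) (V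
  1136)) (V 1136)) (V 1136)) (V 1136)) (V 1136))) (V 1136)) (C 1 4 (C 0 6 (C 1
  7 (C 2 8 (C 3 9 (C 4 10 (C 5 11 (C 6 12 (C 7 13 (C 8 14 (C 9 15 (C 10 16 (C
  11 17 (V 0) (V 522)) (V 772)) (V 772)) (V 965)) (V 1098)) (V 1136)) (V 1109))
  (V 1136)) (V 1136)) (V 1136)) (V 1136)) (V 1136)) (C 0 6 (C 1 7 (C 2 8 (C 3 9
  (C 3 4 (C 4 10 (C 5 11 (C 6 12 (C 7 13 (C 8 14 (C 9 15 (C 10 16 (C 11 17 (V
  0) (V 522)) (V 772)) (V 1136)) (V 1109)) (V 1136)) (V 1109)) (V 1136)) (V
  1136)) (C 4 10 (C 5 11 (C 6 12 (C 7 13 (C 8 14 (C 9 15 (C 10 16 (C 11 17 (V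
  0) (V 522)) (V 772)) (V 1054)) (V 1109)) (V 1136)) (V 1109)) (V 1136)) (V
  1109))) (V 1136)) (V 1109)) (V 1136)) (V 1109)))) (C 0 5 (C 1 6 (C 0 4 (C 2 7
  (C 3 8 (C 4 9 (C 4 10 (C 6 11 (C 7 12 (C 8 13 (C 9 14 (V 0) (V 613)) (V 613))
  (V 894)) (V 1037)) (V 1136)) (V 1136)) (V 1136)) (V 1136)) (C 1 4 (C 2 7 (C 3
  8 (C 4 9 (C 5 10 (C 6 11 (C 7 12 (C 8 13 (C 9 14 (V 0) (V 522)) (V 772)) (V
  1054)) (V 1136)) (V 1109)) (V 1136)) (V 1136)) (V 1109)) (C 3 4 (C 2 7 (C 3 8
  (C 3 9 (C 5 10 (C 6 11 (C 7 12 (C 8 13 (C 8 14 (V 0) (V 522)) (V 1057)) (V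
  1057)) (V 1136)) (V 1136)) (V 1136)) (V 1136)) (V 1136)) (C 2 7 (C 3 8 (C 4 9
  (C 5 10 (C 6 11 (C 7 12 (C 8 13 (C 9 14 (V 0) (V 522)) (V 934)) (V 1136)) (V
  1136)) (V 1136)) (V 1136)) (V 1136)) (V 1136))))) (C 3 4 (C 0 6 (C 1 7 (C 2 8
  (C 3 9 (C 4 10 (C 5 11 (C 6 12 (C 7 13 (C 8 14 (C 9 15 (C 10 16 (C 11 17 (V
  0) (V 613)) (V 613)) (V 951)) (V 951)) (V 1075)) (V 1136)) (V 1136)) (V
  1136)) (V 1136)) (V 1136)) (V 1136)) (V 1136)) (C 1 4 (C 0 6 (C 1 7 (C 2 8 (C
  3 9 (C 4 10 (C 5 11 (C 6 12 (C 7 13 (C 8 14 (C 9 15 (C 10 16 (C 11 17 (V 0)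
  (V 613)) (V 613)) (V 867)) (V 1060)) (V 1136)) (V 1136)) (V 1136)) (V 1136))
  (V 1136)) (V 1136)) (V 1136)) (V 1136)) (C 0 6 (C 1 7 (C 2 8 (C 3 9 (C 4 10
  (C 5 11 (C 6 12 (C 7 13 (C 8 14 (C 9 15 (C 10 16 (C 11 17 (V 0) (V 613)) (V
  613)) (V 894)) (V 1088)) (V 1136)) (V 1136)) (V 1136)) (V 1136)) (V 1136)) (V
  1136)) (V 1136)) (V 1136))))) (C 4 5 (C 0 6 (C 1 7 (C 2 8 (C 3 9 (C 4 10 (C 5
  11 (C 6 12 (C 7 13 (C 8 14 (C 9 15 (C 10 16 (C 11 17 (V 0) (V 522)) (V 1057))
  (V 1057)) (V 1136)) (V 1136)) (V 1136)) (V 1136)) (V 1136)) (V 1136)) (V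
  1136)) (V 1136)) (V 1136)) (C 0 6 (C 1 7 (C 2 8 (C 3 9 (C 4 10 (C 5 11 (C 6
  12 (C 7 13 (C 8 14 (C 9 15 (C 10 16 (C 11 17 (V 0) (V 522)) (V 934)) (V
  1136)) (V 1136)) (V 1136)) (V 1136)) (V 1136)) (V 1136)) (V 1136)) (V 1136))
  (V 1136)) (V 1136)))))))) (C 1 2 (C 0 3 (C 1 4 (C 0 5 (C 0 6 (C 1 7 (C 2 8 (C
  3 9 (C 4 10 (C 5 11 (C 6 12 (C 7 13 (C 8 14 (C 9 15 (V 570) (V 800)) (V 942))
  (V 1018)) (V 1018)) (V 1078)) (V 1078)) (V 1102)) (V 1117)) (V 1125)) (C 1 6
  (C 1 7 (C 3 8 (C 4 9 (C 5 10 (C 6 11 (C 6 12 (C 8 13 (V 554) (V 728)) (V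
  976)) (V 976)) (V 976)) (V 1060)) (V 1087)) (V 1125)) (V 1125))) (C 1 5 (C 0
  6 (C 1 7 (V 539) (V 935)) (V 935)) (C 0 6 (C 1 7 (C 2 8 (C 3 9 (C 4 10 (C 5
  11 (C 6 12 (C 7 13 (C 8 14 (C 9 15 (C 10 16 (V 539) (V 950)) (V 1110)) (V
  1110)) (V 1110)) (V 1110)) (V 1110)) (V 1110)) (V 1110)) (V 1110)) (V 1110))
  (V 1110)))) (C 0 4 (C 1 5 (C 0 6 (C 1 7 (C 2 8 (C 3 9 (C 4 10 (C 5 11 (C 6 12
  (C 7 13 (C 8 14 (C 9 15 (C 10 16 (V 487) (V 789)) (V 951)) (V 951)) (V 1077))
  (V 1077)) (V 1128)) (V 1160)) (V 1177)) (V 1177)) (V 1144)) (C 1 6 (C 3 7 (C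
  3 8 (C 5 9 (V 703) (V 1034)) (V 1034)) (V 1190)) (V 1190))) (C 0 6 (C 1 7 (C
  2 8 (C 3 9 (C 4 10 (C 5 11 (C 6 12 (C 7 13 (C 8 14 (C 9 15 (C 10 16 (V 560)
  (V 971)) (V 1260)) (V 1260)) (V 1269)) (V 1269)) (V 1269)) (V 1269)) (V
  1269)) (V 1269)) (V 1269)) (V 1269))) (C 1 5 (C 0 6 (C 1 7 (C 2 8 (C 3 9 (C 4
  10 (C 5 11 (C 6 12 (C 7 13 (C 8 14 (C 9 15 (C 10 16 (V 560) (V 863)) (V
  1145)) (V 1271)) (V 1272)) (V 1271)) (V 1272)) (V 1271)) (V 1272)) (V 1271))
  (V 1272)) (V 1271)) (C 0 5 (C 1 6 (C 1 7 (C 3 8 (C 4 9 (C 5 10 (C 6 11 (C 6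
  12 (C 8 13 (V 560) (V 971)) (V 1218)) (V 1272)) (V 1272)) (V 1272)) (V 1272))
  (V 1272)) (C 0 6 (C 1 7 (C 2 8 (C 3 9 (C 4 10 (C 5 11 (C 6 12 (C 7 13 (C 8 14
  (C 9 15 (V 711) (V 993)) (V 1135)) (V 1272)) (V 1272)) (V 1272)) (V 1272)) (V
  1272)) (V 1272)) (V 1272)) (V 1272))) (C 4 5 (C 0 6 (C 1 7 (C 2 8 (C 3 9 (C 4
  10 (C 5 11 (C 6 12 (C 7 13 (C 8 14 (C 9 15 (C 10 16 (V 560) (V 1095)) (V
  1095)) (V 1272)) (V 1272)) (V 1272)) (V 1272)) (V 1272)) (V 1272)) (V 1272))
  (V 1272)) (V 1272)) (C 0 6 (C 1 7 (C 2 8 (C 3 9 (C 4 10 (C 5 11 (C 6 12 (C 7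
  13 (C 8 14 (C 9 15 (C 10 16 (V 560) (V 971)) (V 1254)) (V 1272)) (V 1272)) (V
  1272)) (V 1272)) (V 1272)) (V 1272)) (V 1272)) (V 1272)) (V 1272))))))) (C 0
  4 (C 1 5 (C 0 6 (C 1 7 (C 2 8 (C 3 9 (C 4 10 (C 5 11 (C 6 12 (C 7 13 (C 8 14
  (C 9 15 (C 10 16 (V 597) (V 900)) (V 1065)) (V 1259)) (V 1289)) (V 1308)) (V
  1289)) (V 1308)) (V 1289)) (V 1315)) (V 1289)) (C 1 6 (C 3 7 (C 4 8 (C 5 9 (C
  5 10 (V 597) (V 1009)) (V 1308)) (V 1308)) (V 1308)) (V 1308))) (C 0 5 (C 1 6
  (C 1 7 (C 3 8 (C 4 9 (C 4 10 (C 6 11 (C 6 12 (V 691) (V 973)) (V 1219)) (V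
  1219)) (V 1289)) (V 1289)) (V 1289)) (V 1289)) (C 0 6 (C 1 7 (C 2 8 (C 3 9 (C
  4 10 (C 5 11 (C 6 12 (C 7 13 (C 8 14 (C 9 15 (C 10 16 (V 597) (V 1009)) (V
  1255)) (V 1289)) (V 1289)) (V 1289)) (V 1289)) (V 1289)) (V 1289)) (V 1289))
  (V 1289)) (V 1289)))) (C 1 5 (C 1 4 (C 0 6 (C 1 7 (C 2 8 (C 3 9 (C 4 10 (C 5
  11 (C 6 12 (C 7 13 (C 8 14 (C 9 15 (C 10 16 (V 597) (V 1012)) (V 1012)) (V
  1206)) (V 1315)) (V 1315)) (V 1315)) (V 1315)) (V 1315)) (V 1315)) (V 1315))
  (V 1315)) (C 3 4 (C 0 6 (C 1 7 (C 2 8 (C 3 9 (C 4 10 (C 5 11 (C 6 12 (C 7 13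
  (C 8 14 (C 9 15 (C 10 16 (V 597) (V 900)) (V 1267)) (V 1267)) (V 1315)) (V
  1308)) (V 1315)) (V 1315)) (V 1308)) (V 1308)) (V 1315)) (V 1308)) (C 0 6 (C
  1 7 (C 2 8 (C 3 9 (C 4 10 (C 5 11 (C 6 12 (C 7 13 (C 8 14 (C 9 15 (C 10 16 (V
  597) (V 900)) (V 1182)) (V 1308)) (V 1315)) (V 1308)) (V 1315)) (V 1308)) (V
  1308)) (V 1308)) (V 1315)) (V 1308)))) (C 0 5 (C 0 6 (C 3 4 (C 1 7 (C 2 8 (C
  3 9 (C 4 10 (C 5 11 (C 6 12 (C 7 13 (C 8 14 (C 9 15 (V 717) (V 1055)) (V
  1055)) (V 1214)) (V 1214)) (V 1289)) (V 1289)) (V 1315)) (V 1315)) (V 1315))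
  (C 1 4 (C 1 7 (C 2 8 (C 3 9 (C 4 10 (C 5 11 (C 6 12 (C 7 13 (C 8 14 (C 9 15
  (V 717) (V 981)) (V 1175)) (V 1311)) (V 1311)) (V 1315)) (V 1315)) (V 1315))
  (V 1315)) (V 1315)) (C 1 7 (C 2 8 (C 3 9 (C 4 10 (C 5 11 (C 6 12 (C 7 13 (C 8
  14 (C 9 15 (V 717) (V 999)) (V 1192)) (V 1315)) (V 1315)) (V 1315)) (V 1315))
  (V 1315)) (V 1315)) (V 1315)))) (C 1 4 (C 1 6 (C 1 7 (C 3 8 (C 4 9 (C 5 10 (C
  6 11 (C 6 12 (C 8 13 (V 597) (V 900)) (V 1182)) (V 1315)) (V 1308)) (V 1315))
  (V 1308)) (V 1308)) (V 1315)) (C 3 4 (C 1 6 (C 1 7 (C 3 8 (C 3 9 (C 5 10 (C 6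
  11 (C 6 12 (C 8 13 (V 597) (V 1120)) (V 1120)) (V 1315)) (V 1315)) (V 1315))
  (V 1315)) (V 1315)) (V 1315)) (C 1 6 (C 1 7 (C 3 8 (C 4 9 (C 5 10 (C 6 11 (C
  6 12 (C 8 13 (V 597) (V 1009)) (V 1291)) (V 1315)) (V 1315)) (V 1315)) (V
  1315)) (V 1315)) (V 1315))))) (C 4 5 (C 0 6 (C 1 7 (C 2 8 (C 3 9 (C 4 10 (C 5
  11 (C 6 12 (C 7 13 (C 8 14 (C 9 15 (C 10 16 (V 597) (V 1132)) (V 1132)) (V
  1315)) (V 1315)) (V 1315)) (V 1315)) (V 1315)) (V 1315)) (V 1315)) (V 1315))
  (V 1315)) (C 0 6 (C 1 7 (C 2 8 (C 3 9 (C 4 10 (C 5 11 (C 6 12 (C 7 13 (C 8 14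
  (C 9 15 (C 10 16 (V 597) (V 1009)) (C 3 4 (V 1315) (V 1291))) (V 1315)) (V
  1315)) (V 1315)) (V 1315)) (V 1315)) (V 1315)) (V 1315)) (V 1315)) (V
  1315))))))) (C 0 1 (C 0 3 (C 2 4 (C 2 5 (C 0 6 (C 1 7 (C 2 8 (C 3 9 (C 4 10
  (C 5 11 (C 6 12 (C 7 13 (C 8 14 (C 9 15 (C 10 16 (V 0) (V 391)) (V 391)) (V
  549)) (V 646)) (V 699)) (V 699)) (V 740)) (V 740)) (V 756)) (V 766)) (V 772))
  (C 0 5 (C 0 6 (C 2 7 (C 3 8 (C 4 9 (C 5 10 (C 5 11 (C 7 12 (C 8 13 (V 0) (V
  380)) (V 500)) (V 670)) (V 670)) (V 670)) (V 728)) (V 746)) (V 772)) (C 0 6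
  (C 1 7 (C 2 8 (C 3 9 (C 4 10 (C 5 11 (C 6 12 (C 7 13 (C 8 14 (C 9 15 (C 10 16
  (V 0) (V 410)) (V 692)) (V 772)) (V 772)) (V 772)) (V 772)) (V 772)) (V 772))
  (V 772)) (V 772)) (V 772)))) (C 0 4 (C 2 5 (C 0 6 (C 1 7 (V 0) (V 370)) (V
  642)) (C 0 6 (C 1 7 (C 2 8 (C 3 9 (C 4 10 (C 5 11 (C 6 12 (C 7 13 (C 8 14 (C
  9 15 (C 10 16 (V 0) (V 410)) (V 642)) (V 642)) (V 642)) (V 642)) (V 642)) (V
  642)) (V 642)) (V 642)) (V 642)) (V 642))) (C 4 5 (C 0 6 (C 1 7 (C 2 8 (C 3 9
  (C 4 10 (C 5 11 (C 6 12 (C 7 13 (C 8 14 (C 9 15 (C 10 16 (V 0) (V 492)) (V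
  492)) (V 673)) (V 761)) (V 761)) (V 761)) (V 761)) (V 761)) (V 761)) (V 761))
  (V 761)) (C 2 5 (C 0 6 (C 1 7 (C 2 8 (C 3 9 (C 4 10 (C 5 11 (C 6 12 (C 7 13
  (C 8 14 (C 9 15 (C 10 16 (V 0) (V 370)) (V 652)) (V 761)) (V 761)) (V 761))
  (V 761)) (V 761)) (V 761)) (V 761)) (V 761)) (V 761)) (C 0 5 (C 0 6 (C 2 7 (C
  3 8 (C 4 9 (C 5 10 (C 5 11 (C 7 12 (C 8 13 (V 0) (V 410)) (V 617)) (V 761))
  (V 761)) (V 761)) (V 761)) (V 761)) (V 761)) (C 0 6 (C 1 7 (C 2 8 (C 3 9 (C 4
  10 (C 5 11 (C 6 12 (C 7 13 (C 8 14 (C 9 15 (C 10 16 (V 0) (V 410)) (V 692))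
  (V 761)) (V 761)) (V 761)) (V 761)) (V 761)) (V 761)) (V 761)) (V 761)) (V
  761))))))) (C 2 3 (C 0 4 (C 2 5 (C 0 6 (C 1 7 (C 2 8 (C 3 9 (C 4 10 (C 5 11
  (C 6 12 (C 7 13 (C 8 14 (C 9 15 (C 10 16 (V 0) (V 334)) (V 541)) (V 652)) (V
  652)) (V 739)) (V 739)) (V 774)) (V 796)) (V 807)) (V 807)) (V 785)) (C 0 5
  (C 2 6 (C 2 7 (C 4 8 (C 4 9 (C 6 10 (V 0) (V 482)) (V 482)) (V 709)) (V 709))
  (V 816)) (C 0 6 (C 1 7 (C 2 8 (C 3 9 (C 4 10 (C 5 11 (C 6 12 (C 7 13 (C 8 14
  (C 9 15 (C 10 16 (V 0) (V 410)) (V 617)) (V 816)) (V 816)) (V 816)) (V 816))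
  (V 816)) (V 816)) (V 816)) (V 816)) (V 816)))) (C 4 5 (C 0 6 (C 1 7 (C 2 8 (C
  3 9 (C 4 10 (C 5 11 (C 6 12 (C 7 13 (C 8 14 (C 9 15 (C 10 16 (V 0) (V 492))
  (V 492)) (V 724)) (V 724)) (V 833)) (V 833)) (V 871)) (V 871)) (V 871)) (V
  871)) (V 871)) (C 2 5 (C 0 6 (C 1 7 (C 2 8 (C 3 9 (C 4 10 (C 5 11 (C 6 12 (C
  7 13 (C 8 14 (C 9 15 (C 10 16 (V 0) (V 384)) (V 667)) (V 865)) (V 865)) (V
  871)) (V 871)) (V 871)) (V 871)) (V 871)) (V 871)) (V 871)) (C 0 5 (C 0 6 (C
  2 7 (C 2 8 (C 4 9 (C 5 10 (C 5 11 (C 7 12 (C 7 13 (V 0) (V 410)) (V 768)) (V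
  768)) (V 871)) (V 871)) (V 871)) (V 871)) (V 871)) (C 0 6 (C 1 7 (C 2 8 (C 3
  9 (C 4 10 (C 5 11 (C 6 12 (C 7 13 (C 8 14 (C 9 15 (C 10 16 (V 0) (V 410)) (V
  692)) (V 871)) (V 871)) (V 871)) (V 871)) (V 871)) (V 871)) (V 871)) (V 871))
  (V 871)))))) (C 0 4 (C 2 5 (C 0 6 (C 1 7 (C 2 8 (C 3 9 (C 4 10 (C 5 11 (C 6
  12 (C 7 13 (C 8 14 (C 9 15 (C 10 16 (V 0) (V 384)) (V 592)) (V 786)) (V 872))
  (V 873)) (V 872)) (V 873)) (V 872)) (V 873)) (V 872)) (V 873)) (C 0 5 (C 2 6
  (C 3 7 (C 4 8 (C 4 9 (C 6 10 (V 0) (V 410)) (V 692)) (V 872)) (V 872)) (V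
  872)) (C 3 5 (C 0 6 (C 1 7 (C 2 8 (C 3 9 (C 4 10 (C 5 11 (C 6 12 (C 7 13 (C 8
  14 (C 9 15 (C 10 16 (V 0) (V 410)) (V 617)) (V 731)) (V 864)) (V 872)) (V
  872)) (V 872)) (V 872)) (V 872)) (V 872)) (V 872)) (C 0 6 (C 1 7 (C 2 8 (C 3
  9 (C 4 10 (C 5 11 (C 6 12 (C 7 13 (C 8 14 (C 9 15 (C 10 16 (V 0) (V 410)) (V
  617)) (V 811)) (V 872)) (V 872)) (V 872)) (V 872)) (V 872)) (V 872)) (V 872))
  (V 872))))) (C 4 5 (C 2 4 (C 0 6 (C 1 7 (C 2 8 (C 3 9 (C 4 10 (C 5 11 (C 6 12
  (C 7 13 (C 8 14 (C 9 15 (C 10 16 (V 0) (V 488)) (V 488)) (V 681)) (V 779)) (V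
  873)) (V 873)) (V 873)) (V 873)) (V 873)) (V 873)) (V 873)) (C 0 6 (C 1 7 (C
  2 8 (C 3 9 (C 4 10 (C 5 11 (C 6 12 (C 7 13 (C 8 14 (C 9 15 (C 10 16 (V 0) (V
  492)) (V 492)) (V 685)) (V 818)) (V 873)) (V 873)) (V 873)) (V 873)) (V 873))
  (V 873)) (V 873))) (C 3 4 (C 0 5 (C 0 6 (C 2 7 (C 3 8 (C 3 9 (C 5 10 (C 5 11
  (C 7 12 (C 8 13 (V 0) (V 474)) (V 474)) (V 667)) (V 836)) (V 836)) (V 873))
  (V 873)) (V 873)) (C 2 5 (C 0 6 (C 1 7 (C 2 8 (C 3 9 (C 4 10 (C 5 11 (C 6 12
  (C 7 13 (C 8 14 (C 9 15 (C 10 16 (V 0) (V 384)) (V 751)) (V 751)) (V 873)) (V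
  873)) (V 873)) (V 873)) (V 873)) (V 873)) (V 873)) (V 873)) (C 0 6 (C 1 7 (C
  2 8 (C 3 9 (C 4 10 (C 5 11 (C 6 12 (C 7 13 (C 8 14 (C 9 15 (C 10 16 (V 0) (V
  410)) (V 777)) (V 777)) (V 873)) (V 873)) (V 873)) (V 873)) (V 873)) (V 873))
  (V 873)) (V 873)))) (C 2 5 (C 0 6 (C 1 7 (C 2 8 (C 3 9 (C 4 10 (C 5 11 (C 6
  12 (C 7 13 (C 8 14 (C 9 15 (C 10 16 (V 0) (V 384)) (V 667)) (V 860)) (V 873))
  (V 873)) (V 873)) (V 873)) (V 873)) (V 873)) (V 873)) (V 873)) (C 0 5 (C 2 4
  (C 0 6 (C 2 7 (C 3 8 (C 4 9 (C 5 10 (C 5 11 (C 7 12 (C 8 13 (V 0) (V 384)) (V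
  667)) (V 836)) (V 873)) (V 873)) (V 873)) (V 873)) (V 873)) (C 0 6 (C 2 7 (C
  3 8 (C 4 9 (C 5 10 (C 5 11 (C 7 12 (C 8 13 (V 0) (V 410)) (V 692)) (V 873))
  (V 873)) (V 873)) (V 873)) (V 873)) (V 873))) (C 0 6 (C 1 7 (C 2 8 (C 3 9 (C
  4 10 (C 5 11 (C 6 12 (C 7 13 (C 8 14 (C 9 15 (C 10 16 (V 0) (V 410)) (V 692))
  (C 3 5 (V 861) (V 873))) (V 873)) (V 873)) (V 873)) (V 873)) (V 873)) (V
  873)) (V 873)) (V 873))))))))) (C 0 3 (C 1 4 (C 0 5 (C 1 6 (C 2 7 (C 3 8 (C 4
  9 (C 5 10 (C 6 11 (C 7 12 (C 8 13 (C 9 14 (V 0) (V 598)) (V 957)) (V 1128))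
  (V 1322)) (V 1378)) (V 1360)) (V 1378)) (V 1378)) (C 0 6 (C 1 7 (C 2 8 (C 3 9
  (C 4 10 (C 5 11 (C 6 12 (C 7 13 (C 8 14 (C 9 15 (C 10 16 (C 11 17 (V 0) (V
  761)) (V 761)) (V 1025)) (V 1167)) (V 1300)) (V 1360)) (V 1360)) (V 1360)) (V
  1360)) (V 1360)) (V 1360)) (V 1360))) (C 1 5 (C 0 6 (C 1 7 (C 2 8 (C 3 9 (C 4
  10 (C 5 11 (C 6 12 (C 7 13 (C 8 14 (C 9 15 (C 10 16 (C 11 17 (V 0) (V 599))
  (V 1020)) (V 1020)) (V 1194)) (V 1327)) (V 1379)) (V 1379)) (V 1379)) (V
  1379)) (V 1379)) (V 1379)) (V 1379)) (C 2 5 (C 0 6 (C 1 7 (C 2 8 (V 0) (V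
  599)) (V 1010)) (V 1292)) (C 0 6 (C 1 7 (C 2 8 (C 3 9 (C 4 10 (C 5 11 (C 6 12
  (C 7 13 (C 8 14 (C 9 15 (C 10 16 (C 11 17 (V 0) (V 599)) (V 1010)) (V 1292))
  (V 1379)) (V 1379)) (V 1379)) (V 1379)) (V 1379)) (V 1379)) (V 1379)) (V
  1379)) (V 1379))))) (C 0 5 (C 0 6 (C 2 4 (C 1 7 (C 2 8 (C 3 9 (C 4 10 (C 5 11
  (C 6 12 (C 7 13 (C 8 14 (C 9 15 (C 10 16 (C 11 17 (V 0) (V 779)) (V 779)) (V
  1061)) (V 1203)) (V 1281)) (V 1372)) (V 1378)) (V 1378)) (V 1378)) (V 1378))
  (V 1378)) (C 1 7 (C 2 8 (C 3 9 (C 4 10 (C 5 11 (C 6 12 (C 7 13 (C 8 14 (C 9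
  15 (C 10 16 (C 11 17 (V 0) (V 779)) (V 779)) (V 1061)) (V 1203)) (V 1336)) (V
  1378)) (V 1378)) (V 1378)) (V 1378)) (V 1378)) (V 1378))) (C 2 4 (C 1 6 (C 2
  7 (C 3 8 (C 4 9 (C 5 10 (C 6 11 (C 7 12 (C 8 13 (C 9 14 (V 0) (V 598)) (V
  1009)) (V 1256)) (V 1373)) (V 1378)) (V 1378)) (V 1378)) (V 1378)) (V 1378))
  (C 1 6 (C 2 7 (C 3 8 (C 4 9 (C 5 10 (C 6 11 (C 7 12 (C 8 13 (C 9 14 (V 0) (V
  598)) (V 1010)) (V 1256)) (V 1378)) (V 1378)) (V 1378)) (V 1378)) (V 1378))
  (V 1378)))) (C 1 5 (C 0 4 (C 2 6 (C 3 7 (C 3 8 (C 5 9 (C 6 10 (C 7 11 (V 0)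
  (V 779)) (V 779)) (V 1061)) (V 1254)) (V 1378)) (C 0 6 (C 1 7 (C 2 8 (C 3 9
  (C 4 10 (C 5 11 (C 6 12 (C 7 13 (C 8 14 (C 9 15 (C 10 16 (C 11 17 (V 0) (V
  598)) (V 957)) (V 1128)) (V 1128)) (V 1261)) (V 1352)) (V 1378)) (V 1360)) (V
  1378)) (V 1378)) (V 1378)) (V 1378))) (C 0 6 (C 1 7 (C 2 8 (C 3 9 (C 4 10 (C
  5 11 (C 6 12 (C 7 13 (C 8 14 (C 9 15 (C 10 16 (C 11 17 (V 0) (V 598)) (V
  957)) (V 1239)) (V 1378)) (V 1378)) (V 1378)) (V 1378)) (V 1378)) (V 1378))
  (V 1378)) (V 1378)) (V 1378))) (C 4 5 (C 2 4 (C 0 6 (C 1 7 (C 2 8 (C 3 9 (C 4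
  10 (C 5 11 (C 6 12 (C 7 13 (C 8 14 (C 9 15 (C 10 16 (C 11 17 (V 0) (V 598))
  (V 1121)) (V 1121)) (V 1302)) (V 1378)) (V 1378)) (V 1378)) (V 1378)) (V
  1378)) (V 1378)) (V 1378)) (V 1378)) (C 0 6 (C 1 7 (C 2 8 (C 3 9 (C 4 10 (C 5
  11 (C 6 12 (C 7 13 (C 8 14 (C 9 15 (C 10 16 (C 11 17 (V 0) (V 598)) (V 1133))
  (V 1133)) (V 1315)) (V 1378)) (V 1378)) (V 1378)) (V 1378)) (V 1378)) (V
  1378)) (V 1378)) (V 1378))) (C 0 4 (C 0 6 (C 1 7 (C 2 8 (C 3 9 (C 4 10 (C 5
  11 (C 6 12 (C 7 13 (C 8 14 (C 9 15 (C 10 16 (C 11 17 (V 0) (V 598)) (V 1010))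
  (V 1298)) (V 1298)) (V 1378)) (V 1378)) (V 1378)) (V 1378)) (V 1378)) (V
  1378)) (V 1378)) (V 1378)) (C 0 6 (C 1 7 (C 2 8 (C 3 9 (C 4 10 (C 5 11 (C 6
  12 (C 7 13 (C 8 14 (C 9 15 (C 10 16 (C 11 17 (V 0) (V 598)) (V 1010)) (V
  1292)) (V 1378)) (V 1378)) (V 1378)) (V 1378)) (V 1378)) (V 1378)) (V 1378))
  (V 1378)) (V 1378))))))) (C 0 4 (C 1 3 (C 0 5 (C 1 6 (C 2 7 (C 3 8 (C 4 9 (C
  4 10 (C 6 11 (C 7 12 (C 8 13 (C 9 14 (V 0) (V 779)) (V 779)) (V 1043)) (V
  1237)) (V 1353)) (V 1379)) (V 1379)) (V 1379)) (V 1379)) (C 1 5 (C 2 6 (C 1 7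
  (C 4 8 (C 3 9 (C 6 10 (C 5 11 (V 0) (V 599)) (V 958)) (V 1240)) (V 1379)) (V
  1379)) (C 0 6 (C 1 7 (C 2 8 (C 3 9 (C 4 10 (C 5 11 (C 6 12 (C 7 13 (C 8 14 (C
  9 15 (C 10 16 (C 11 17 (V 0) (V 599)) (V 958)) (V 1207)) (V 1207)) (V 1340))
  (V 1379)) (V 1379)) (V 1379)) (V 1379)) (V 1379)) (V 1379)) (V 1379))) (C 0 6
  (C 1 7 (C 2 8 (C 3 9 (C 4 10 (C 5 11 (C 6 12 (C 7 13 (C 8 14 (C 9 15 (C 10 16
  (C 11 17 (V 0) (V 599)) (V 1010)) (V 1256)) (V 1379)) (V 1379)) (V 1379)) (V
  1379)) (V 1379)) (V 1379)) (V 1379)) (V 1379)) (V 1379)))) (C 1 5 (C 2 6 (C 2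
  3 (C 2 7 (C 4 8 (C 5 9 (C 6 10 (C 6 11 (V 0) (V 599)) (V 1134)) (V 1134)) (V
  1327)) (V 1379)) (C 3 7 (C 4 8 (C 5 9 (C 6 10 (C 7 11 (V 0) (V 599)) (V
  1010)) (V 1292)) (V 1379)) (V 1379))) (C 0 6 (C 1 7 (C 2 8 (C 3 9 (C 4 10 (C
  5 11 (C 6 12 (C 7 13 (C 8 14 (C 9 15 (C 10 16 (C 11 17 (V 0) (V 599)) (V
  958)) (V 1129)) (C 2 3 (V 1379) (V 1323))) (V 1360)) (V 1379)) (V 1360)) (V
  1379)) (C 2 3 (V 1379) (V 1360))) (V 1379)) (V 1360)) (V 1379))) (C 0 5 (C 2
  3 (C 1 6 (C 2 7 (C 2 8 (C 4 9 (C 4 10 (C 6 11 (C 7 12 (C 7 13 (C 9 14 (V 0)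
  (V 761)) (V 761)) (V 1087)) (V 1087)) (V 1219)) (V 1335)) (V 1335)) (V 1360))
  (V 1360)) (C 1 6 (C 2 7 (C 3 8 (C 4 9 (C 4 10 (C 6 11 (C 7 12 (C 8 13 (C 9 14
  (V 0) (V 761)) (V 761)) (V 1042)) (V 1236)) (V 1360)) (V 1360)) (V 1360)) (V
  1360)) (V 1360))) (C 0 6 (C 1 7 (C 2 8 (C 3 9 (C 4 10 (C 5 11 (C 6 12 (C 7 13
  (C 8 14 (C 9 15 (C 10 16 (C 11 17 (V 0) (V 599)) (V 1010)) (V 1256)) (V
  1360)) (V 1360)) (V 1360)) (V 1360)) (V 1360)) (V 1360)) (V 1360)) (V 1360))
  (V 1360))))) (C 0 5 (C 0 6 (C 3 4 (C 1 3 (C 1 7 (C 2 8 (C 3 9 (C 4 10 (C 5 11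
  (C 6 12 (C 7 13 (C 8 14 (C 9 15 (C 10 16 (C 11 17 (V 0) (V 779)) (V 779)) (V
  1114)) (V 1114)) (V 1247)) (V 1314)) (V 1379)) (V 1379)) (V 1379)) (V 1379))
  (V 1379)) (C 1 7 (C 2 8 (C 3 9 (C 4 10 (C 5 11 (C 6 12 (C 7 13 (C 8 14 (C 9
  15 (C 10 16 (C 11 17 (V 0) (V 779)) (V 779)) (V 1117)) (V 1117)) (V 1250)) (V
  1341)) (V 1379)) (V 1379)) (V 1379)) (V 1379)) (V 1379))) (C 1 4 (C 2 3 (C 1
  7 (C 2 8 (C 3 9 (C 4 10 (C 5 11 (C 6 12 (C 7 13 (C 8 14 (C 9 15 (C 10 16 (C
  11 17 (V 0) (V 779)) (V 779)) (V 1043)) (V 1295)) (V 1295)) (V 1379)) (V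
  1379)) (V 1379)) (V 1379)) (V 1379)) (V 1379)) (C 1 7 (C 2 8 (C 3 9 (C 4 10
  (C 5 11 (C 6 12 (C 7 13 (C 8 14 (C 9 15 (C 10 16 (C 11 17 (V 0) (V 779)) (V
  779)) (V 1043)) (V 1237)) (V 1370)) (V 1379)) (V 1379)) (V 1379)) (V 1379))
  (V 1379)) (V 1379))) (C 2 3 (C 1 7 (C 2 8 (C 3 9 (C 4 10 (C 5 11 (C 6 12 (C 7
  13 (C 8 14 (C 9 15 (C 10 16 (C 11 17 (V 0) (V 779)) (V 779)) (V 1061)) (V
  1313)) (V 1313)) (V 1379)) (V 1379)) (V 1379)) (V 1379)) (V 1379)) (V 1379))
  (C 1 7 (C 2 8 (C 3 9 (C 4 10 (C 5 11 (C 6 12 (C 7 13 (C 8 14 (C 9 15 (C 10 16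
  (C 11 17 (V 0) (V 779)) (V 779)) (V 1061)) (V 1254)) (C 2 4 (V 1370) (V
  1379))) (V 1379)) (V 1379)) (V 1379)) (V 1379)) (V 1379)) (V 1379))))) (C 1 4
  (C 1 3 (C 1 6 (C 2 7 (C 3 8 (C 3 9 (C 5 10 (C 6 11 (C 7 12 (C 8 13 (C 8 14 (V
  0) (V 599)) (V 1020)) (V 1020)) (V 1213)) (V 1311)) (V 1379)) (V 1379)) (V
  1379)) (V 1379)) (C 2 3 (C 1 6 (C 2 7 (C 2 8 (C 4 9 (C 5 10 (C 6 11 (C 7 12
  (C 7 13 (C 9 14 (V 0) (V 599)) (V 958)) (V 1325)) (V 1325)) (V 1379)) (V
  1379)) (V 1379)) (V 1379)) (V 1379)) (C 1 6 (C 2 7 (C 3 8 (C 4 9 (C 5 10 (C 6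
  11 (C 7 12 (C 8 13 (C 9 14 (V 0) (V 599)) (V 958)) (V 1240)) (V 1379)) (V
  1379)) (V 1379)) (V 1379)) (V 1379)) (V 1379)))) (C 3 4 (C 1 6 (C 2 7 (C 3 8
  (C 3 9 (C 5 10 (C 6 11 (C 7 12 (C 8 13 (C 8 14 (V 0) (V 599)) (V 1121)) (V
  1121)) (V 1315)) (V 1379)) (V 1379)) (V 1379)) (V 1379)) (V 1379)) (C 2 3 (C
  1 6 (C 2 7 (C 2 8 (C 4 9 (C 5 10 (C 6 11 (C 7 12 (C 7 13 (C 9 14 (V 0) (V
  599)) (V 1010)) (V 1369)) (V 1369)) (V 1379)) (V 1379)) (V 1379)) (V 1379))
  (V 1379)) (C 1 6 (C 2 7 (C 3 8 (C 4 9 (C 5 10 (C 6 11 (C 7 12 (C 8 13 (C 9 14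
  (V 0) (V 599)) (V 1010)) (V 1292)) (V 1379)) (V 1379)) (V 1379)) (V 1379)) (V
  1379)) (V 1379)))))) (C 4 5 (C 1 4 (C 2 3 (C 0 6 (C 1 7 (C 2 8 (C 3 9 (C 4 10
  (C 5 11 (C 6 12 (C 7 13 (C 8 14 (C 9 15 (C 10 16 (C 11 17 (V 0) (V 599)) (V
  1020)) (V 1020)) (V 1252)) (V 1252)) (V 1337)) (V 1379)) (V 1379)) (V 1379))
  (V 1379)) (V 1379)) (V 1379)) (C 0 6 (C 1 7 (C 2 8 (C 3 9 (C 4 10 (C 5 11 (C
  6 12 (C 7 13 (C 8 14 (C 9 15 (C 10 16 (C 11 17 (V 0) (V 599)) (V 1020)) (V
  1020)) (V 1213)) (V 1346)) (V 1379)) (V 1379)) (V 1379)) (V 1379)) (V 1379))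
  (V 1379)) (V 1379))) (C 2 3 (C 0 6 (C 1 7 (C 2 8 (C 3 9 (C 4 10 (C 5 11 (C 6
  12 (C 7 13 (C 8 14 (C 9 15 (C 10 16 (C 11 17 (V 0) (V 599)) (V 1134)) (V
  1134)) (V 1366)) (V 1366)) (V 1379)) (V 1379)) (V 1379)) (V 1379)) (V 1379))
  (V 1379)) (V 1379)) (C 0 6 (C 1 7 (C 2 8 (C 3 9 (C 4 10 (C 5 11 (C 6 12 (C 7
  13 (C 8 14 (C 9 15 (C 10 16 (C 11 17 (V 0) (V 599)) (V 1134)) (V 1134)) (V
  1327)) (V 1379)) (V 1379)) (V 1379)) (V 1379)) (V 1379)) (V 1379)) (V 1379))
  (V 1379)))) (C 1 5 (C 3 4 (C 0 6 (C 1 7 (C 2 8 (C 3 9 (C 4 10 (C 5 11 (C 6 12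
  (C 7 13 (C 8 14 (C 9 15 (C 10 16 (C 11 17 (V 0) (V 599)) (V 958)) (V 1325))
  (V 1325)) (V 1379)) (V 1379)) (V 1379)) (V 1379)) (V 1379)) (V 1379)) (V
  1379)) (V 1379)) (C 0 6 (C 1 7 (C 2 8 (C 3 9 (C 4 10 (C 5 11 (C 6 12 (C 7 13
  (C 8 14 (C 9 15 (C 10 16 (C 11 17 (V 0) (V 599)) (V 958)) (V 1240)) (V 1379))
  (V 1379)) (V 1379)) (V 1379)) (V 1379)) (V 1379)) (V 1379)) (V 1379)) (V
  1379))) (C 3 4 (C 0 6 (C 1 7 (C 2 8 (C 3 9 (C 4 10 (C 5 11 (C 6 12 (C 7 13 (C
  8 14 (C 9 15 (C 10 16 (C 11 17 (V 0) (V 599)) (V 1010)) (C 1 3 (C 2 5 (V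
  1368) (V 1377)) (V 1377))) (C 1 3 (C 2 5 (V 1368) (V 1377)) (V 1377))) (V
  1379)) (V 1379)) (V 1379)) (V 1379)) (V 1379)) (V 1379)) (V 1379)) (V 1379))
  (C 0 6 (C 1 7 (C 2 8 (C 3 9 (C 4 10 (C 5 11 (C 6 12 (C 7 13 (C 8 14 (C 9 15
  (C 10 16 (C 11 17 (V 0) (V 599)) (V 1010)) (V 1292)) (V 1379)) (V 1379)) (V
  1379)) (V 1379)) (V 1379)) (V 1379)) (V 1379)) (V 1379)) (V 1379)))))))))).

Lemma weight_tree_growth : explore (growth_check weight_tree) 30 2 [:: 0; 1].
(* Depth 30 suffices: the tree reads positions below 18, so 18 letters of the word decide every
   test. *)
Proof. vm_cast_no_check (erefl true). Qed.

(** Periods 1 to 17 suffice, because from 18 on the tree sees only the first copy of u. *)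
Lemma weight_tree_cube :
  all (fun p => explore (cube_check weight_tree p) 30 0 [::]) (iota 1 17).
Proof. vm_cast_no_check (erefl true). Qed.

(** With pairwise distinct letters every test fails, which leads to the maximal leaf; this is the
    weight of the empty word. *)
Lemma eval_fresh (U : eqType) (g : nat -> U) :
  injective g -> eval weight_tree g = 1379%num.
Proof.
move=> g_inj; apply: (@peval_sound _ g _ (iota 0 18)) => //.
split=> [? ? _ _ /g_inj // | i].
by rewrite size_iota => lt_i; rewrite nth_iota.
Qed.

Import Order.TTheory GRing.Theory Num.Theory.

(** * The geometric series over cube periods *)

Section GeometricTail.
Local Open Scope ring_scope.

Lemma geometric_tail (F : realFieldType) (x : F) n : 0 < x < 1 ->
  \sum_(7 <= p < n) x ^+ (2 * p).-1 <= x ^+ 13 / (1 - x ^+ 2).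
Proof.
case/andP=> x_gt0 x_lt1.
have x2_lt1 : 0 < 1 - x ^+ 2 by rewrite subr_gt0 exprn_ilt1 // ltW.
have C_gt0 : 0 < x ^+ 13 / (1 - x ^+ 2) by rewrite divr_gt0 ?exprn_gt0.
have [le_n7 | lt_7n] := leqP n 7; first by rewrite big_geq // ltW.
rewrite -(subnKC (ltnW lt_7n)); move: (n - 7)%N => k.
(* The partial sum with [k] terms has a closed form, which is the full series times a factor at most
   1. *)
suff -> : \sum_(7 <= p < 7 + k) x ^+ (2 * p).-1 =
    x ^+ 13 / (1 - x ^+ 2) * (1 - x ^+ (2 * k)).
  by rewrite ger_pMr // gerBl exprn_ge0 ?ltW.
elim: k => [|k IHk].
  by rewrite addn0 big_geq // muln0 expr0 subrr mulr0.
rewrite addnS big_nat_recr ?leq_addr // IHk.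
have -> : ((2 * (7 + k)).-1 = 13 + 2 * k)%N by lia.
have -> : (2 * k.+1 = 2 + 2 * k)%N by lia.
rewrite -[LHS]/(_ + _) (exprD x 13) (exprD x 2); set z := x ^+ (2 * k).
field.
by rewrite lt0r_neq0.
Qed.

(** The bound 97/2500 is small enough that 1.455 - 2.354 * 97/2500 >= 15/11. *)
Lemma tail_bound (F : realFieldType) (x : F) : x = 11 / 15 ->
  x ^+ 13 / (1 - x ^+ 2) <= 97 / 2500.
Proof.
move=> Ex; have x2 : x ^+ 2 = 121 / 225 by rewrite Ex; field.
(* Rounding the fourth power up keeps the fractions small and leaves enough room. *)
have x4 : 0 <= x ^+ 4 <= 2893 / 10000 by rewrite (exprM x 2 2) x2; lra.
have x12 : x ^+ 12 <= (2893 / 10000) ^+ 3.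
  by case/andP: x4 => *; rewrite (exprM x 4 3) lerXn2r // nnegrE; lra.
rewrite x2 ler_pdivrMr; last lra.
by rewrite exprS; move: (x ^+ 12) x12 => z; rewrite Ex; lra.
Qed.

End GeometricTail.

(** * Weights of finite words and initial cubes *)

Section Weight.
Variable T : choiceType.
Implicit Types (w : seq T).

(* Beyond its end, a word is continued by pairwise distinct fresh letters. *)
Definition letter_at w : nat -> T + nat :=
  fun i => nth (inr (i - size w)) [seq inl a | a <- w] i.

Definition weight w : nat := N.to_nat (eval weight_tree (letter_at w)).

Lemma letter_at_cons x w : letter_at (x :: w) =1 scons (inl x) (letter_at w).
Proof. by case. Qed.

(** Fresh letters are numbered from the end of the word, so removing letters at the front does not
    change them. *)
Lemma letter_at_drop k w : k <= size w ->
  letter_at (drop k w) =1 shift (letter_at w) k.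
Proof.
move=> le_k i; rewrite /letter_at /shift map_drop nth_drop size_drop.
by congr nth; congr inr; lia.
Qed.

Lemma letter_at_fresh w i : letter_at w (size w + i) = inr i.
Proof.
by rewrite /letter_at nth_default ?size_map ?leq_addr //; congr inr; lia.
Qed.

Lemma letter_at_nil : injective (letter_at [::]).
Proof. by move=> i j; rewrite !(letter_at_fresh [::] _) => -[]. Qed.

Lemma weight_nil : weight [::] = 1379.
Proof. by rewrite /weight eval_fresh //; apply: letter_at_nil. Qed.

Lemma weight_le w : weight w <= 1379.
Proof.
have := @eval_max _ weight_tree (letter_at w); rewrite /weight.
have -> : max_leaf weight_tree = 1379%num by vm_compute.
lia.
Qed.

(** The first 3p letters have period p: letters 0 to 2p-1 agree with letters p to 3p-1. *)
Definition starts_with_cube p w : bool :=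
  (3 * p <= size w) && (take (2 * p) w == take (2 * p) (drop p w)).

Lemma starts_with_cubeP p w : starts_with_cube p w ->
  forall i, i < 2 * p -> letter_at w i = letter_at w (p + i).
Proof.
case/andP=> size_w /eqP Ew i lt_i.
have := letter_at_drop (k := p) (w := w) _ i; rewrite /shift => <-; last lia.
rewrite /letter_at !(set_nth_default (inr 0)) ?size_map ?size_drop //; try lia.
rewrite -(nth_take _ lt_i) -[RHS](nth_take _ lt_i) -!map_take.
by rewrite Ew.
Qed.

Lemma starts_with_cube_cat u v : starts_with_cube (size u) (u ++ u ++ u ++ v).
Proof.
rewrite /starts_with_cube !size_cat; apply/andP; split; first lia.
rewrite drop_size_cat // !catA -catA take_size_cat ?size_cat; last lia.
by rewrite take_size_cat ?size_cat //; lia.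
Qed.

(** The 2p removed letters are two copies of the first p letters that remain. *)
Lemma starts_with_cube_inj p w w' :
  starts_with_cube p w -> starts_with_cube p w' ->
  drop (2 * p) w = drop (2 * p) w' -> w = w'.
Proof.
have tk v : starts_with_cube p v ->
    take (2 * p) v = take p (drop (2 * p) v) ++ take p (drop (2 * p) v).
  case/andP=> size_v /eqP Ev.
  have E1 : take p (drop p v) = take p v.
    have := congr1 (take p) Ev; rewrite !take_takel; [by []|lia|lia].
  have E2 : take p (drop p (drop p v)) = take p (drop p v).
    have := congr1 (take p \o drop p) Ev; rewrite /= mul2n -addnn.
    by rewrite -!take_drop !take_takel // => ->.
  rewrite mul2n -addnn -drop_drop E2 E1.
  by rewrite takeD E1.
move=> w_p w'_p Ed.
by rewrite -(cat_take_drop (2 * p) w) -[RHS](cat_take_drop (2 * p)) !tk // Ed.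
Qed.

(** * The words that are counted *)

Definition admissible w : bool :=
  (0 < weight w) && all (fun p => ~~ starts_with_cube p w) (iota 1 (size w)).

Variable A : nat -> {fset T}.

Definition extensions m (l : seq (seq T)) : seq (seq T) :=
  [seq x :: w | w <- l, x <- enum_fset (A m)].

(** Each word is tested when its newest letter is put in front, so it suffices that [admissible]
    looks at initial cubes: all other factors were tested earlier. *)
Fixpoint good n : seq (seq T) :=
  if n is m.+1 then [seq w <- extensions m (good m) | admissible w]
  else [:: [::]].

Lemma extensionsP m l w : reflect
  (exists x v, [/\ w = x :: v, x \in A m & v \in l]) (w \in extensions m l).
Proof.
apply: (iffP allpairsPdep) => [[v [x [lv Ax ->]]] | [x [v [-> Ax lv]]]].
  by exists x, v.
by exists v, x.
Qed.

Lemma extensions_uniq m l : uniq l -> uniq (extensions m l).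
Proof.
move=> ul; apply: allpairs_uniq => //.
by move=> [v x] [v' x'] _ _ /= [-> ->].
Qed.

Lemma good_uniq n : uniq (good n).
Proof. by elim: n => //= n IHn; apply: filter_uniq; apply: extensions_uniq. Qed.

Lemma good_size n w : w \in good n -> size w = n.
Proof.
elim: n w => [|n IHn] w /=; first by rewrite inE => /eqP->.
by rewrite mem_filter => /andP[_ /extensionsP[x [v [-> _ /IHn /= ->]]]].
Qed.

Lemma good_drop k n w : w \in good n -> drop k w \in good (n - k).
Proof.
elim: k n w => [|k IHk] n w; first by rewrite drop0 subn0.
case: n => [|n] /=; first by rewrite inE => /eqP->.
rewrite mem_filter => /andP[_ /extensionsP[x [v [-> _ /IHk]]]].
by rewrite subSS.
Qed.

Lemma good_admissible n w : w \in good n.+1 -> admissible w.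
Proof. by rewrite mem_filter => /andP[]. Qed.

(** A nonempty suffix is itself good, hence of positive weight; at or past the end of [w] only fresh
    letters remain, and the weight is 1379. *)
Lemma good_live n w k : w \in good n ->
  eval weight_tree (shift (letter_at w) k) <> 0%num.
Proof.
move=> wn; have sw := good_size wn; case: (leqP k n) => [le_kn | lt_nk].
  rewrite -(eval_ext _ (letter_at_drop _)) ?sw //.
  have := good_drop k wn; case: (n - k) => [|m].
    by rewrite inE => /eqP->; rewrite eval_fresh //; apply: letter_at_nil.
  by case/good_admissible/andP => + _; rewrite /weight; lia.
rewrite eval_fresh // => i j; rewrite /shift.
have fr a : letter_at w (k + a) = inr (k + a - n).
  by rewrite -(letter_at_fresh w) sw; congr letter_at; lia.
by rewrite !fr => -[]; lia.
Qed.

Lemma good_cube_free n w : w \in good n -> cube_free (rev w).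
Proof.
move=> wn u u_neq0; apply/infixP => -[a [b Ew]].
have {}Ew : w = rev b ++ rev u ++ rev u ++ rev u ++ rev a.
  by rewrite -[w]revK Ew !rev_cat -!catA.
(* Dropping the letters in front of the cube leaves a good word that starts with it, contrary to
   admissibility. *)
have := good_drop (size b) wn.
rewrite Ew drop_size_cat ?size_rev //.
set v := rev u ++ _ => vm; have sv := good_size vm.
have u_gt0 : 0 < size u by case: (u) u_neq0.
have lt_u : size u < (size v).+1 by rewrite /v !size_cat size_rev; lia.
case: (n - size b) vm sv => [_ sv | m /good_admissible/andP[_ /allP ncube] sv].
  by move: lt_u u_gt0; rewrite sv; lia.
have := ncube (size u); rewrite mem_iota add1n u_gt0 lt_u => /(_ isT).
by rewrite /v -(size_rev u) starts_with_cube_cat.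
Qed.

Lemma good_words n w : w \in good n -> rev w \in words A n.
Proof.
elim: n w => [|n IHn] w /=; first by rewrite !inE => /eqP->.
rewrite mem_filter => /andP[_ /extensionsP[x [v [-> Ax /IHn Av]]]].
by rewrite rev_cons; apply: in_imfset2.
Qed.

Lemma size_good n : size (good n) <= #|` cube_free_words A n|%fset.
Proof.
rewrite -(size_map rev); apply: uniq_leq_size.
  by rewrite map_inj_uniq ?good_uniq //; apply: can_inj revK.
move=> _ /mapP[w wn ->]; rewrite !inE /=; apply/andP; split.
  exact: good_words.
by apply/asboolP; apply: good_cube_free wn.
Qed.

(** * The two weight inequalities on good words *)

Lemma weight_growth n w x y : w \in good n -> x <> y ->
  1455 * weight w <= 1000 * (weight (x :: w) + weight (y :: w)).
Proof.
move=> wn xy.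
have xy' : (inl x : T + nat) <> inl y by case.
have := growth_sound weight_tree_growth xy' (fun k => @good_live n w k wn).
by rewrite -!(eval_ext _ (letter_at_cons _ _)) /weight; lia.
Qed.

Lemma weight_cube n x w p : w \in good n -> 0 < p ->
  starts_with_cube p (x :: w) ->
  1000 * weight (x :: w) <=
    if p <= 6 then 0 else 2354 * weight (drop (2 * p) (x :: w)).
Proof.
move=> wn p_gt0 cube; have size_w : 3 * p <= size (x :: w) by case/andP: cube.
have drop_w := letter_at_drop (k := 2 * p) (w := x :: w) _.
rewrite /weight (eval_ext _ (drop_w _)); last lia.
have [lt_p | le_p] := ltnP p 18.
  have ex : explore (cube_check weight_tree p) 30 0 [::].
    by move/allP: weight_tree_cube; apply; rewrite mem_iota; lia.
  have live k : eval weight_tree (shift (letter_at (x :: w)) k.+1) <> 0%num.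
    exact: good_live wn.
  have := cube_sound p_gt0 ex (starts_with_cubeP cube) live.
  by case: ifP; lia.
have -> : (p <= 6) = false by lia.
(* For p >= 18 the 18 letters read lie in the first copy of u, so both weights are equal. *)
rewrite (@eval_reads _ 18 _ _ (shift (letter_at (x :: w)) (2 * p))); first lia.
  by vm_compute.
move=> i lt_i; rewrite /shift (starts_with_cubeP cube); last lia.
rewrite (starts_with_cubeP cube (i := p + i)); last lia.
by congr letter_at; lia.
Qed.

(** * The recurrence for the total weight *)

Definition total n : nat := \sum_(w <- good n) weight w.

Hypothesis cardA : forall i : nat, #|` A i|%fset = 2.

Lemma sum_extensions m :
  1455 * total m <= 1000 * \sum_(w <- extensions m (good m)) weight w.
Proof.
rewrite big_allpairs_dep /= !big_distrr /= big_seq [leqRHS]big_seq.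
apply: leq_sum => w wm.
have := cardA m; have := fset_uniq (A m).
(* Exactly two distinct letters are available, so property (1) applies to this pair. *)
case: (enum_fset (A m)) => [|x [|y [|z s]]] //=.
rewrite inE andbT => /eqP xy _; rewrite !big_cons big_nil addn0.
exact: weight_growth wm xy.
Qed.

Lemma sum_cubes m p : 6 < p ->
  1000 * \sum_(w <- extensions m (good m) | starts_with_cube p w) weight w
    <= 2354 * total (m.+1 - 2 * p).
Proof.
move=> p_gt6; rewrite big_distrr /= big_seq_cond.
apply: (@leq_trans (\sum_(w <- extensions m (good m) | starts_with_cube p w)
   2354 * weight (drop (2 * p) w))).
  rewrite [leqRHS]big_seq_cond; apply: leq_sum => w'.
  case/andP=> /extensionsP[x [w [-> _ wm]]] cube.
  by have := weight_cube wm _ cube; rewrite [p <= 6]leqNgt p_gt6 /=; apply; lia.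
rewrite -big_filter -(big_map (drop (2 * p)) xpredT (fun w => 2354 * weight w)).
rewrite [leqRHS]big_distrr.
(* The shortened words are distinct and good, so their sum is at most the total for their length. *)
apply: (@uniq_sub_le_big _ addn leq leqnn (fun i j => leq_addr j i));
  last 2 first.
- exact: good_uniq.
- move=> _ /mapP[w + ->]; rewrite mem_filter => /andP[/andP[size_w _]].
  case/extensionsP=> x [v [Ew _ vm]]; rewrite Ew.
  (* As p > 0, the new letter is among those removed, so what remains is a suffix of the good word
     [v]. *)
  case: p p_gt6 size_w => // p _ _; rewrite mulnS /= subSS.
  exact: good_drop.
rewrite map_inj_in_uniq ?filter_uniq ?extensions_uniq ?good_uniq //.
move=> w w'; rewrite !mem_filter => /andP[w_p _] /andP[w'_p _].
exact: starts_with_cube_inj.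
Qed.

(** A union bound: a rejected extension has weight 0 or starts with a cube. Periods up to 6 again
    give weight 0, and any longer period p satisfies 3p <= m+1, so it lies in the range of the
    sum. *)
Lemma total_step m :
  \sum_(w <- extensions m (good m)) weight w <= total m.+1
    + \sum_(7 <= p < m.+1./2.+1)
        \sum_(w <- extensions m (good m) | starts_with_cube p w) weight w.
Proof.
rewrite /total /= big_filter.
under [X in _ <= _ + X]eq_bigr do rewrite big_mkcond.
(* After exchanging the sums, the inequality is checked word by word. *)
rewrite exchange_big /= [X in _ <= X + _]big_mkcond -big_split /=.
rewrite big_seq [leqRHS]big_seq.
apply: leq_sum => _ /extensionsP[x [w [-> _ wm]]].
case: ifP => [_ | /negbT]; first exact: leq_addr.
rewrite negb_and -eqn0Ngt => /orP[/eqP-> // |].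
case/allPn => p; rewrite mem_iota negbK add1n /= (good_size wm).
move=> /andP[p_gt0 p_lt] cube.
have := weight_cube wm p_gt0 cube; case: (leqP p 6) => [_ | p_gt6 _]; first lia.
have le_p : 3 * p <= m.+1 by case/andP: (cube) => /=; rewrite (good_size wm).
have p_in : p \in index_iota 7 m.+1./2.+1 by rewrite mem_index_iota; lia.
by rewrite add0n (bigD1_seq p) ?iota_uniq //= cube leq_addr.
Qed.

Lemma total_recurrence m :
  1455 * total m <= 1000 * total m.+1
    + 2354 * \sum_(7 <= p < m.+1./2.+1) total (m.+1 - 2 * p).
Proof.
apply: leq_trans (sum_extensions m) _.
apply: leq_trans (leq_mul (leqnn 1000) (total_step m)) _.
rewrite mulnDr leq_add2l !big_distrr /= big_seq [leqRHS]big_seq.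
apply: leq_sum => p; rewrite mem_index_iota => /andP[p_gt6 _].
exact: sum_cubes.
Qed.

(** * Exponential growth *)

Local Open Scope ring_scope.

Variables (F : realFieldType) (x : F).
Hypothesis Ex : x = 11 / 15.

Let x_gt0 : 0 < x. Proof. by rewrite Ex; lra. Qed.

Let x_lt1 : x < 1. Proof. by rewrite Ex; lra. Qed.

Lemma total_growth m : (total m)%:R <= x * (total m.+1)%:R.
Proof.
elim/ltn_ind: m => m IHm.
(* Iterating the induction hypothesis backwards bounds all earlier totals by powers of [x] times the
   current one. *)
have back j : (j <= m)%N -> (total (m - j))%:R <= x ^+ j * (total m)%:R.
  elim: j => [_|j IHj lt_j]; first by rewrite subn0 expr0 mul1r.
  have step := IHm (m - j.+1)%N _; rewrite -subSn // subSS in step.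
  rewrite exprS -mulrA; apply: le_trans (step _) _; first lia.
  by rewrite ler_pM2l // IHj // ltnW.
have := total_recurrence m; rewrite -(ler_nat F) natrD !natrM natr_sum => rec.
have sum_le : \sum_(7 <= p < m.+1./2.+1) (total (m.+1 - 2 * p))%:R
     <= 97 / 2500 * (total m)%:R :> F.
  have := le_trans (geometric_tail m.+1./2.+1 _) (tail_bound Ex).
  rewrite x_gt0 x_lt1 => /(_ isT) tail_le.
  apply: le_trans (ler_wpM2r (ler0n _ _) tail_le).
  rewrite mulr_suml big_seq [leRHS]big_seq; apply: ler_sum => p.
  rewrite mem_index_iota => /andP[p_gt6 p_lt].
  (* Measured from [m], a cube of period p goes back 2p-1 steps, which is the exponent in the
     series. *)
  have -> : (m.+1 - 2 * p = m - (2 * p).-1)%N by lia.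
  by apply: back; lia.
move: rec sum_le; have := ler0n F (total m).
set t := (total m)%:R; set t' := (total m.+1)%:R; set s := \sum_(_ <= _ < _) _.
rewrite Ex; lra.
Qed.

(** No weight exceeds that of the empty word, so the factor 1379 cancels between the total weight
    and the number of words. *)
Lemma good_growth n : (27 / 20) ^+ n <= (size (good n))%:R :> F.
Proof.
have M_gt0 : 0 < 1379%:R :> F by rewrite ltr0n.
have tot_n : 1379%:R <= x ^+ n * (total n)%:R.
  elim: n => [|n IHn]; first by rewrite expr0 mul1r /total big_seq1 weight_nil.
  rewrite exprSr -mulrA; apply: le_trans IHn _.
  by rewrite ler_pM2l ?exprn_gt0 // total_growth.
have le_tot : (total n <= 1379 * size (good n))%N.
  rewrite /total -sum1_size big_distrr /=; apply: leq_sum => w _.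
  by rewrite muln1 weight_le.
rewrite -(ler_nat F) natrM in le_tot.
have x_n : 0 < x ^+ n by rewrite exprn_gt0.
have : 1 <= x ^+ n * (size (good n))%:R.
  rewrite -(ler_pM2l M_gt0) mulr1 mulrCA; apply: le_trans tot_n _.
  by rewrite ler_pM2l.
(* Here 27/20 * 11/15 = 99/100, so the growth factor 15/11 exceeds 1.35. *)
have : (27 / 20 * x) ^+ n <= 1 by rewrite exprn_ile1 // Ex; lra.
rewrite exprMn => pow_le size_ge.
by rewrite -(ler_pM2r x_n) [leRHS]mulrC (le_trans pow_le).
Qed.

End Weight.

Local Open Scope ring_scope.

Theorem theorem2 (T : choiceType) (A : nat -> {fset T})
    (cardA : forall i : nat, #|` A i|%fset = 2%N) (n : nat) :
  (1.35%Q ^+ n <= (#|` cube_free_words A n|%fset)%:R :> rat).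
Proof.
have -> : 1.35%Q = 27 / 20 :> rat by apply/eqP.
apply: le_trans (good_growth cardA erefl n) _.
by rewrite ler_nat size_good.
Qed.
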